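(* Let $B$ be a unital C$^*$-algebra, let $A$ be a C$^*$-subalgebra of $B$ containing the unit of $B$, and let $T:A\to B$ be a continuous linear map which is a triple derivation at the unit of $A$. Then $T$ is a generalized derivation.
   Context: For $a,b,c$ in a C$^*$-algebra, $\{a,b,c\}=\frac12(ab^*c+cb^*a)$. A linear map $T:A\to B$ is a triple derivation at $z\in A$ if for all $a,b,c\in A$ with $\{a,b,c\}=z$ one has $T(z)=\{T(a),b,c\}+\{a,T(b),c\}+\{a,b,T(c)\}$. A linear map $G:A\to B$ is a generalized derivation if there exists $\xi\in B^{**}$ such that $G(ab)=G(a)b+aG(b)-a\xi b$ for all $a,b\in A$ (products taken in the von Neumann algebra $B^{**}$). *)

(* Defs.v *)
From HB Require Import structures.
From mathcomp Require Import all_boot all_order all_algebra.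
From mathcomp Require Import complex ring.
From mathcomp Require Import boolp classical_sets functions filter reals.
From mathcomp Require Import topology normedtype.

Set Implicit Arguments.
Unset Strict Implicit.
Unset Printing Implicit Defensive.

Import Order.TTheory GRing.Theory Num.Theory.
Local Open Scope classical_set_scope.
Local Open Scope ring_scope.
Local Open Scope complex_scope.

Reserved Notation "x ** y" (at level 40, left associativity).

(* The product is a field of the mixin, not the one of [pzRingType]: in the
   hierarchy the only common extension of rings and of normed Z-modules is
   [numDomainType], so a structure extending both is rejected. A
   [normedModType R[i]] has its norm valued in R[i]; norms are nonnegative,
   hence real. *)
HB.mixin Record isCStarAlg (R : realType) B & CompleteNormedModule R[i] B := {
  cmul : B -> B -> B ;
  star : B -> B ;
  cmulA : associative cmul ;
  cmulDl : forall x y z : B, cmul (x + y) z = cmul x z + cmul y z ;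
  cmulDr : forall x y z : B, cmul x (y + z) = cmul x y + cmul x z ;
  cmulZl : forall (k : R[i]) (x y : B), cmul (k *: x) y = k *: cmul x y ;
  cmulZr : forall (k : R[i]) (x y : B), cmul x (k *: y) = k *: cmul x y ;
  norm_cmul : forall x y : B, `|cmul x y| <= `|x| * `|y| ;
  starK : involutive star ;
  starD : {morph star : x y / x + y} ;
  starZ : forall (k : R[i]) (x : B), star (k *: x) = k^* *: star x ;
  starM : forall x y : B, star (cmul x y) = cmul (star y) (star x) ;
  cstar_identity : forall x : B, `|cmul (star x) x| = `|x| ^+ 2
}.

#[short(type="cstarAlgType")]
HB.structure Definition CStarAlg (R : realType) :=
  {B of isCStarAlg R B & CompleteNormedModule R[i] B}.

Notation "x ** y" := (cmul x y) : ring_scope.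

(* The zero algebra is allowed: [cone != 0] is not required. *)
HB.mixin Record hasUnit (R : realType) B & CStarAlg R B := {
  cone : B ;
  cmul1x : left_id cone cmul ;
  cmulx1 : right_id cone cmul
}.

#[short(type="unitalCStarAlgType")]
HB.structure Definition UnitalCStarAlg (R : realType) :=
  {B of hasUnit R B & CStarAlg R B}.

Definition triple {R : realType} {B : cstarAlgType R} (a b c : B) : B :=
  (2^-1 : R[i]) *: (a ** star b ** c + c ** star b ** a).

HB.mixin Record isCStarClosed (R : realType) (B : cstarAlgType R)
    (S : {pred B}) := {
  cmul_closed : forall x y, x \in S -> y \in S -> x ** y \in S ;
  star_closed : forall x, x \in S -> star x \in S ;
  topology_closed : closed [set x : B | x \in S]
}.

(* [SubmodClosed] contains 0 and is closed under addition and scaling. *)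
#[short(type="cstarSubalg")]
HB.structure Definition CStarSubalg (R : realType) (B : cstarAlgType R) :=
  {S of isCStarClosed R B S & @GRing.SubmodClosed R[i] B S}.

Section ElementsOfSubalgebra.
Context {R : realType} {B : cstarAlgType R} (A : cstarSubalg B).

(* The elements of A, themselves a C*-algebra for the restricted structure. *)
Definition elt : Type := {x : B | x \in A}.

HB.instance Definition _ := [isSub of elt for @sval B (fun x => x \in A)].
HB.instance Definition _ := [Choice of elt by <:].
HB.instance Definition _ := [SubChoice_isSubLmodule of elt by <:].

Definition elt_norm (x : elt) : R[i] := `|\val x|.

Let elt_ler_normD x y : elt_norm (x + y) <= elt_norm x + elt_norm y.
Proof. by rewrite /elt_norm raddfD ler_normD. Qed.

Let elt_normrZ (k : R[i]) x : elt_norm (k *: x) = `|k| * elt_norm x.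
Proof. by rewrite /elt_norm linearZ normrZ. Qed.

Let elt_normr0_eq0 x : elt_norm x = 0 -> x = 0.
Proof. by move=> /normr0_eq0 x0; apply/val_inj; rewrite raddf0. Qed.

HB.instance Definition _ := Lmodule_isNormed.Build R[i] elt
  elt_ler_normD elt_normrZ elt_normr0_eq0.


Let elt_complete (F : set_system elt) : ProperFilter F -> cauchy F -> cvg F.
Proof.
move=> FF /cauchy_ballP Fc.
have /cauchy_cvg cF : cauchy (val @ F).
  apply/cauchy_ballP => e e0; have := Fc _ e0.
  case=> -[P Q] /= [FP FQ] PQ; exists (val @` P, val @` Q).
    by split; [apply: filterS FP => x Px|apply: filterS FQ => x Qx]; exists x.
  move=> [_ _] /= [[x Px <-] [y Qy <-]]; have := PQ (x, y) (conj Px Qy).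
  by rewrite /= -!ball_normE /= /Num.norm/= /elt_norm raddfB.
have [l Fl] : exists l : B, val @ F --> l by exists (lim (val @ F)).
have lA : l \in A.
  have FA : \forall x \near F, [set y : B | y \in A] (val x).
    by apply: nearW => x /=; exact: valP.
  have cA : closed [set y : B | y \in A] by exact: topology_closed.
  exact: (@closed_cvg elt B F _ val (fun y => y \in A) cA FA l Fl).
apply/cvg_ex; exists (Sub l lA : elt); apply/cvgrPdist_lt => e e0.
by move/cvgrPdist_lt : Fl => /(_ e e0).
Qed.

HB.instance Definition _ := Uniform_isComplete.Build elt elt_complete.

Definition elt_mul (x y : elt) : elt :=
  Sub (\val x ** \val y) (cmul_closed _ _ (valP x) (valP y)).

Definition elt_star (x : elt) : elt :=
  Sub (star (\val x)) (star_closed _ (valP x)).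

Let elt_mulA : associative elt_mul.
Proof. by move=> x y z; apply: val_inj; rewrite /= cmulA. Qed.

Let elt_mulDl : forall x y z, elt_mul (x + y) z = elt_mul x z + elt_mul y z.
Proof. by move=> x y z; apply: val_inj; rewrite /= ?raddfD/= cmulDl. Qed.

Let elt_mulDr : forall x y z, elt_mul x (y + z) = elt_mul x y + elt_mul x z.
Proof. by move=> x y z; apply: val_inj; rewrite /= ?raddfD/= cmulDr. Qed.

Let elt_mulZl : forall (k : R[i]) x y, elt_mul (k *: x) y = k *: elt_mul x y.
Proof. by move=> k x y; apply: val_inj; rewrite /= ?linearZ/= cmulZl. Qed.

Let elt_mulZr : forall (k : R[i]) x y, elt_mul x (k *: y) = k *: elt_mul x y.
Proof. by move=> k x y; apply: val_inj; rewrite /= ?linearZ/= cmulZr. Qed.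

Let elt_norm_mul : forall x y, `|elt_mul x y| <= `|x| * `|y|.
Proof. by move=> x y; exact: norm_cmul. Qed.

Let elt_starK : involutive elt_star.
Proof. by move=> x; apply: val_inj; rewrite /= starK. Qed.

Let elt_starD : {morph elt_star : x y / x + y}.
Proof. by move=> x y; apply: val_inj; rewrite /= ?raddfD/= starD. Qed.

Let elt_starZ : forall (k : R[i]) x, elt_star (k *: x) = k^* *: elt_star x.
Proof. by move=> k x; apply: val_inj; rewrite /= ?linearZ/= starZ. Qed.

Let elt_starM : forall x y, elt_star (elt_mul x y) = elt_mul (elt_star y) (elt_star x).
Proof. by move=> x y; apply: val_inj; rewrite /= starM. Qed.

Let elt_cstar_identity : forall x, `|elt_mul (elt_star x) x| = `|x| ^+ 2.
Proof. by move=> x; exact: cstar_identity. Qed.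

HB.instance Definition _ := isCStarAlg.Build R elt
  elt_mulA elt_mulDl elt_mulDr elt_mulZl elt_mulZr elt_norm_mul
  elt_starK elt_starD elt_starZ elt_starM elt_cstar_identity.

Lemma val_cmul (x y : elt) : \val (x ** y) = \val x ** \val y. Proof. by []. Qed.
Lemma val_star (x : elt) : \val (star x) = star (\val x). Proof. by []. Qed.
Lemma val_norm (x : elt) : `|\val x| = `|x|. Proof. by []. Qed.

End ElementsOfSubalgebra.

Section Dual.
Context {R : realType} (V : normedModType R[i]).

Definition dual_pred : {pred V -> R[i]^o} :=
  fun f => `[< linear f /\ continuous f >].

Record dual := Dual { dual_fun :> V -> R[i]^o ; dualP : dual_fun \in dual_pred }.

HB.instance Definition _ := [isSub for dual_fun].
HB.instance Definition _ := gen_eqMixin dual.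
HB.instance Definition _ := gen_choiceMixin dual.

Lemma dual_linear (f : dual) : linear f.
Proof. by case: f => f /= /asboolP[]. Qed.

HB.instance Definition _ (f : dual) :=
  GRing.isLinear.Build R[i] V R[i]^o _ f (dual_linear f).

Lemma dual_continuous (f : dual) : continuous f.
Proof. by case: f => f /= /asboolP[]. Qed.

Let dual_submod_closed : submod_closed dual_pred.
Proof.
split.
  apply/asboolP; split; last exact: cst_continuous.
  by move=> k x y /=; rewrite scaler0 addr0.
move=> k f g /asboolP[lf cf] /asboolP[lg cg]; apply/asboolP; split.
  move=> a x y; rewrite -[LHS]/(k * f (a *: x + y) + g (a *: x + y)).
  rewrite -[RHS]/(a * (k * f x + g x) + (k * f y + g y)) lf lg.
  by rewrite -[a *: f x]/(a * f x) -[a *: g x]/(a * g x); ring.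
by move=> x; apply: cvgD; [apply: cvgZr; exact: cf|exact: cg].
Qed.

HB.instance Definition _ :=
  GRing.isSubmodClosed.Build R[i] (V -> R[i]^o) dual_pred dual_submod_closed.
HB.instance Definition _ := [SubChoice_isSubLmodule of dual by <:].

Lemma dualD (f g : dual) x : (f + g) x = f x + g x. Proof. by []. Qed.
Lemma dualZ (k : R[i]) (f : dual) x : (k *: f) x = k *: f x. Proof. by []. Qed.

Lemma nonneg_complexE (z : R[i]) : 0 <= z -> (complex.Re z)%:C = z.
Proof. by move=> z0; rewrite RRe_real// ger0_real. Qed.

Lemma dual_bounded (f : dual) :
  exists2 M : R, 0 <= M & forall x, `|f x| <= M%:C * `|x|.
Proof.
have /(@linear_boundedP R[i] V R[i]^o f)/pinfty_ex_gt0[r r0 fr] :=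
  (@linear_bounded_continuous R[i] V R[i]^o f).2 (dual_continuous (f := f)).
have rE := nonneg_complexE (ltW r0).
exists (complex.Re r); first by rewrite -ler0c rE ltW.
by rewrite rE.
Qed.

Definition dual_ball_values (f : dual) : set R :=
  [set complex.Re `|f x| | x in [set x : V | `|x| <= 1]].

Definition dual_norm (f : dual) : R[i] := (sup (dual_ball_values f))%:C.

Let dual_ball_values0 f : dual_ball_values f 0.
Proof. by exists 0; [rewrite /= normr0 ler01|rewrite linear0 normr0]. Qed.

Let dual_ball_values_ub f : has_sup (dual_ball_values f).
Proof.
split; first by exists 0; exact: dual_ball_values0.
have [M M0 fM] := dual_bounded f; exists M => _ [x x1 <-].
rewrite -lecR nonneg_complexE//; apply: (le_trans (fM x)).
by rewrite ler_piMr// ler0c.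
Qed.

Let dual_norm_ge0 f : 0 <= dual_norm f.
Proof.
by rewrite ler0c; apply: ub_le_sup => //; case: (dual_ball_values_ub f).
Qed.

Lemma dual_norm_bound (f : dual) x : `|f x| <= dual_norm f * `|x|.
Proof.
have [->|x0] := eqVneq x 0; first by rewrite linear0 !normr0 mulr0.
have nx0 : 0 < `|x| by rewrite normr_gt0.
rewrite -ler_pdivrMr//.
have -> : `|f x| / `|x| = `|f (`|x|^-1 *: x)|.
  by rewrite linearZ normrZ normfV normr_id mulrC.
rewrite -(nonneg_complexE (normr_ge0 (f _))) lecR.
apply: ub_le_sup; first by case: (dual_ball_values_ub f).
exists (`|x|^-1 *: x) => //.
by rewrite /= normrZ normfV normr_id mulVf ?gt_eqF.
Qed.

Lemma dual_norm_least (f : dual) (M : R[i]) : 0 <= M ->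
  (forall x, `|f x| <= M * `|x|) -> dual_norm f <= M.
Proof.
move=> M0 fM; rewrite -(nonneg_complexE M0) lecR; apply: ge_sup.
  by exists 0; exact: dual_ball_values0.
move=> _ [x x1 <-]; rewrite -lecR !nonneg_complexE//.
by apply: (le_trans (fM x)); rewrite ler_piMr.
Qed.

Let dual_ler_normD f g : dual_norm (f + g) <= dual_norm f + dual_norm g.
Proof.
apply: dual_norm_least => [|x]; first by rewrite addr_ge0.
rewrite dualD (le_trans (ler_normD _ _))// mulrDl.
by rewrite lerD// dual_norm_bound.
Qed.

Let dual_normrZ_le (k : R[i]) f : dual_norm (k *: f) <= `|k| * dual_norm f.
Proof.
apply: dual_norm_least => [|x]; first by rewrite mulr_ge0.
by rewrite dualZ normrZ -mulrA ler_wpM2l// dual_norm_bound.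
Qed.

Let dual_normrZ (k : R[i]) f : dual_norm (k *: f) = `|k| * dual_norm f.
Proof.
apply/eqP; rewrite eq_le dual_normrZ_le /=.
have [->|k0] := eqVneq k 0; first by rewrite normr0 mul0r.
rewrite -ler_pdivlMl ?normr_gt0// -normfV.
by rewrite -{1}[f](scalerK k0) dual_normrZ_le.
Qed.

Let dual_normr0_eq0 f : dual_norm f = 0 -> f = 0.
Proof.
move=> f0; apply: val_inj; apply/funext => x /=.
by apply/eqP; rewrite -normr_le0 (le_trans (dual_norm_bound f x))// f0 mul0r.
Qed.

HB.instance Definition _ := Lmodule_isNormed.Build R[i] dual
  dual_ler_normD dual_normrZ dual_normr0_eq0.

Lemma dual_le_norm (f : dual) x : `|f x| <= `|f| * `|x|.
Proof. exact: dual_norm_bound. Qed.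

Lemma dual_norm_le (f : dual) (M : R[i]) : 0 <= M ->
  (forall x, `|f x| <= M * `|x|) -> `|f| <= M.
Proof. exact: dual_norm_least. Qed.

Lemma dualP_eq (f g : dual) : f =1 g -> f = g.
Proof. by move=> fg; apply: val_inj; apply/funext. Qed.

Lemma bounded_dual_pred (f : V -> R[i]^o) (M : R[i]) : linear f -> 0 <= M ->
  (forall x, `|f x| <= M * `|x|) -> f \in dual_pred.
Proof.
move=> lf M0 fM; apply/asboolP; split=> //.
pose g : {linear V -> R[i]^o} :=
  HB.pack f (GRing.isLinear.Build R[i] V R[i]^o *:%R f lf).
apply: (@bounded_linear_continuous R[i] V R[i]^o g).
apply/(@bounded_funP R[i] V R[i]^o g) => r; exists (M * r) => x xr.
by rewrite (le_trans (fM x))// ler_wpM2l.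
Qed.
End Dual.

Arguments dual_pred {R} V _.

Section Embedding.
Context {R : realType} {V : normedModType R[i]}.

Let eval_dual (x : V) : (fun f : dual V => f x) \in dual_pred (dual V).
Proof.
apply: (@bounded_dual_pred _ _ _ `|x|) => [k f g|//|f]; first by [].
by rewrite mulrC dual_le_norm.
Qed.

Definition bidual_inj (x : V) : dual (dual V) := Dual (eval_dual x).

Lemma bidual_injE (x : V) (f : dual V) : bidual_inj x f = f x.
Proof. by []. Qed.

End Embedding.

Section Arens.
Context {R : realType} {B : cstarAlgType R}.
Implicit Types (f : dual B) (F G : dual (dual B)) (a b : B).

Let translate_dual f a : (fun b => f (a ** b)) \in dual_pred B.
Proof.
apply: (@bounded_dual_pred _ _ _ (`|f| * `|a|)) => [k x y||x].
  by rewrite cmulDr cmulZr linearP.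
  by rewrite mulr_ge0.
by rewrite (le_trans (dual_le_norm _ _))// -mulrA ler_wpM2l// norm_cmul.
Qed.

Definition translate f a : dual B := Dual (translate_dual f a).

Let norm_translate f a : `|translate f a| <= `|f| * `|a|.
Proof.
apply: dual_norm_le => [|x]; first by rewrite mulr_ge0.
by rewrite (le_trans (dual_le_norm f (a ** x)))// -mulrA ler_wpM2l// norm_cmul.
Qed.

Let contract_dual G f : (fun a => G (translate f a)) \in dual_pred B.
Proof.
apply: (@bounded_dual_pred _ _ _ (`|G| * `|f|)) => [k x y||x].
  have -> : translate f (k *: x + y) = k *: translate f x + translate f y.
    by apply: dualP_eq => b; rewrite dualD dualZ /= cmulDl cmulZl linearP.
  by rewrite linearP.
  by rewrite mulr_ge0.
by rewrite (le_trans (dual_le_norm G (translate f x)))// -mulrA ler_wpM2l.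
Qed.

Definition contract G f : dual B := Dual (contract_dual G f).

Let norm_contract G f : `|contract G f| <= `|G| * `|f|.
Proof.
apply: dual_norm_le => [|x]; first by rewrite mulr_ge0.
by rewrite (le_trans (dual_le_norm G (translate f x)))// -mulrA ler_wpM2l.
Qed.

Let arens_dual F G : (fun f => F (contract G f)) \in dual_pred (dual B).
Proof.
apply: (@bounded_dual_pred _ _ _ (`|F| * `|G|)) => [k f g||f].
  have -> : contract G (k *: f + g) = k *: contract G f + contract G g.
    apply: dualP_eq => b; rewrite dualD dualZ /=.
    have -> : translate (k *: f + g) b = k *: translate f b + translate g b.
      by apply: dualP_eq.
    by rewrite linearP.
  by rewrite linearP.
  by rewrite mulr_ge0.
by rewrite (le_trans (dual_le_norm F (contract G f)))// -mulrA ler_wpM2l.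
Qed.

(* First Arens product: <F G, f> = <F, a |-> <G, b |-> f (a b)>>. It is the
   product of the enveloping von Neumann algebra, since C*-algebras are Arens
   regular (the second Arens product is the same) and the product of a von
   Neumann algebra is separately weak* continuous. *)
Definition arens F G : dual (dual B) := Dual (arens_dual F G).

Lemma bidual_injM a b : bidual_inj (a ** b) = arens (bidual_inj a) (bidual_inj b).
Proof. by apply: dualP_eq. Qed.

End Arens.

Definition triple_derivation_at {R : realType} {B : cstarAlgType R}
    {A : cstarSubalg B} (T : elt A -> B) (z : elt A) : Prop :=
  forall a b c : elt A, triple a b c = z ->
    T z = triple (T a) (\val b) (\val c) + triple (\val a) (T b) (\val c)
          + triple (\val a) (\val b) (T c).

Definition generalized_derivation {R : realType} {B : cstarAlgType R}
    {A : cstarSubalg B} (G : elt A -> B) : Prop :=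
  exists xi : dual (dual B), forall a b : elt A,
    bidual_inj (G (a ** b)) =
      arens (bidual_inj (G a)) (bidual_inj (\val b))
      + arens (bidual_inj (\val a)) (bidual_inj (G b))
      - arens (arens (bidual_inj (\val a)) xi) (bidual_inj (\val b)).

(* Main.v *)
Require Import Defs.
From HB Require Import structures.
From mathcomp Require Import all_boot all_order all_algebra.
From mathcomp Require Import complex.
From mathcomp Require Import boolp classical_sets functions filter reals.
From mathcomp Require Import topology normedtype.
From Stdlib Require Ncring Ncring_tac.

Set Implicit Arguments.
Unset Strict Implicit.
Unset Printing Implicit Defensive.

Import Order.TTheory GRing.Theory Num.Theory.
Local Open Scope classical_set_scope.
Local Open Scope ring_scope.

(** Replacing [T] by [D a = T a - T(1) a], which is possible because [T(1)] is
skew and left multiplication by a skew element is a triple derivation, reduces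
the theorem to showing that [D] is a derivation; [xi] is then [T(1)], an
element of [B] itself.

If [a] is invertible then the triple product of [a], the adjoint of its
inverse, and [1] is [1].  Applied to [a = 1 - t x] and expanded in powers of
[t], the hypothesis says that [D] commutes with the involution (order 1) and
that [D (x x) = D x x + x D x] (order 2): [D] is a symmetric Jordan derivation
([inverse_identity_star], [inverse_identity_jder]).

It remains to show that a bounded symmetric Jordan derivation has zero defect
[defect D a b = D (a b) - D a b - a D b].  The defect is bilinear, and
skew elements, which span the algebra, are the first order terms of their
Cayley transforms ([unitary_span]); so it suffices that
[X = defect D v u] vanishes for unitaries [v] and [u] ([defect_unitary]).
This is done without any functional calculus.

- Two evaluations of one Jordan expression give [X r c + c r X = 0] for all
  [r] in [A], where [c = v u - u v] ([defect_bracket]).  As [D] is symmetric,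
  the adjoint of [X] lies in [A X A], so although [X] is only in [B] the usual
  argument for semiprime rings applies and [X A c = 0 = c A X].
- Hence the commutator [g = v^-1 u v u^-1] acts as the identity next to [X].
  The map [a |-> defect D a u] is again a Jordan derivation.  Evaluated
  between two copies of [X] along [w g^n], it gives a sequence with vanishing
  second differences; such a sequence is bounded only if it is constant, so
  [g] can be inserted without changing the value
  ([sandwich_jder_translate]).  As that map sends [v] to [X] and
  [v g = u v u^-1] to [u^-1 X u], between two copies of [X] the element [X]
  may be replaced by its conjugates under [u] ([sandwich_conj]).
- The cocycle identity writes [defect D v (u^n)] as the sum of the
  [u^k X u^(n-1-k)] for [k < n].  Between two copies of [X] that is a sum of
  [n] equal terms, up to a power of [u], whereas the left side is bounded in
  [n].  So [X A X A X = 0], and then [X = 0].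

Apart from the Neumann series, the only analysis is one principle: a bounded
arithmetic progression is constant ([bounded_affine]). *)

(** * Noncommutative ring identities *)

Section RingStructure.
Context {R : realType} {B : unitalCStarAlgType R}.

#[global] Instance cstar_ring_ops : @Ncring.Ring_ops B
  0 cone +%R cmul (fun x y => x - y) -%R eq := {}.

#[global] Instance cstar_ring : Ncring.Ring (Ro := cstar_ring_ops).
Proof.
split; try exact _; try (by move=> ? ? -> ? ? ->); try (by move=> ? ? ->).
- exact: add0r.
- exact: addrC.
- exact: addrA.
- exact: cmul1x.
- exact: cmulx1.
- exact: cmulA.
- exact: cmulDl.
- by move=> x y z; exact: cmulDr.
- by [].
- exact: subrr.
Qed.

End RingStructure.

Ltac nc_ring := Ncring_tac.non_commutative_ring.

Section Linear.
Context {R : realType} {B : unitalCStarAlgType R}.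
Implicit Types x y p q : B.

(** The next lemma, with its variant for twice an equation, proves an identity
    that is a linear combination of known ones: the side condition is a formal
    identity in a free ring, which [nc_ring] decides. *)
Lemma eq_of_eq x y p q : p = q -> x - y = p - q -> x = y.
Proof. by move=> -> /eqP; rewrite subrr subr_eq0 => /eqP. Qed.

Lemma double_eq0 x : x + x = 0 -> x = 0.
Proof.
by rewrite -mulr2n -scaler_nat => /eqP; rewrite scaler_eq0 pnatr_eq0 => /eqP.
Qed.

Lemma eq_of_double_eq x y p q :
  p = q -> (x - y) + (x - y) = p - q -> x = y.
Proof.
by move=> ->; rewrite subrr => /double_eq0/eqP; rewrite subr_eq0 => /eqP.
Qed.

Lemma cmul0x x : 0 ** x = 0. Proof. nc_ring. Qed.
Lemma cmulx0 x : x ** 0 = 0. Proof. nc_ring. Qed.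
End Linear.

(** * Jordan derivations and their defect *)

Section JordanDerivations.
Context {R : realType} {A B : unitalCStarAlgType R}.

(** In the application [j] is the inclusion of a subalgebra; a homomorphism
    keeps the multiplications of the two algebras apart. *)
Record unital_star_hom (j : A -> B) : Prop := UnitalStarHom {
  homM : forall a b, j (a ** b) = j a ** j b;
  hom1 : j cone = cone;
  hom_star : forall a, j (star a) = star (j a);
  hom_le : forall a, `|j a| <= `|a| }.

Context (j : {linear A -> B}) (hj : unital_star_hom j).

Record jordan_derivation (D : A -> B) : Prop := JordanDerivation {
  jderD : forall a b, D (a + b) = D a + D b;
  jder_sq : forall a, D (a ** a) = D a ** j a + j a ** D a }.

Definition defect (D : A -> B) a b := D (a ** b) - D a ** j b - j a ** D b.

Section One.
Variables (D : A -> B) (hD : jordan_derivation D).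
Let DD := jderD hD.

Lemma jder1 : D cone = 0.
Proof.
have := jder_sq hD cone; rewrite cmul1x (hom1 hj) cmulx1 cmul1x => e.
by apply: (eq_of_eq (esym e)); nc_ring.
Qed.

Lemma jder_anti a b : D (a ** b + b ** a) =
  D a ** j b + j a ** D b + D b ** j a + j b ** D a.
Proof.
have := jder_sq hD (a + b); rewrite linearD DD.
have -> : (a + b) ** (a + b) = a ** a + (a ** b + b ** a) + b ** b by nc_ring.
rewrite !DD !(jder_sq hD) => e.
by apply: (eq_of_eq e); nc_ring.
Qed.

Lemma jder_quad a b : D (a ** b ** a) =
  D a ** j b ** j a + j a ** D b ** j a + j a ** j b ** D a.
Proof.
(* This expresses [2 a b a] through anticommutators and squares. *)
have e : a ** b ** a + a ** b ** a + (a ** a ** b + b ** (a ** a))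
  = a ** (a ** b + b ** a) + (a ** b + b ** a) ** a by nc_ring.
have := congr1 D e.
rewrite jder_anti DD jder_anti DD !(jder_sq hD) jder_anti.
rewrite linearD !(homM hj) => {}e.
by apply: (eq_of_double_eq e); nc_ring.
Qed.

Lemma jder_triple a b c : D (a ** b ** c + c ** b ** a) =
  D a ** j b ** j c + j a ** D b ** j c + j a ** j b ** D c +
  (D c ** j b ** j a + j c ** D b ** j a + j c ** j b ** D a).
Proof.
have e : (a + c) ** b ** (a + c) =
  (a ** b ** a + c ** b ** c) + (a ** b ** c + c ** b ** a) by nc_ring.
have := congr1 D e.
rewrite [X in _ = X -> _]DD (DD (a ** b ** a)) !jder_quad linearD DD => {}e.
by apply: (eq_of_eq (esym e)); nc_ring.
Qed.

Lemma defectC a b : defect D b a = - defect D a b.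
Proof.
have := jder_anti a b; rewrite DD => e.
by apply: (eq_of_eq e); rewrite /defect; nc_ring.
Qed.

Lemma defect_diag a : defect D a a = 0.
Proof. by rewrite /defect (jder_sq hD); nc_ring. Qed.

(** The defect is the Hochschild coboundary of [D], up to sign. *)
Lemma defect_cocycle a b c : defect D (a ** b) c + defect D a b ** j c =
  defect D a (b ** c) + j a ** defect D b c.
Proof. by rewrite /defect !(homM hj) cmulA; nc_ring. Qed.

(** The element [a b r b a + b a r a b] is a Jordan triple product both of
    [a b], [r], [b a] and, iterated, of [a] with [b r b] and of [b] with
    [a r a]; the identity compares the two values of [D]. *)
Lemma defect_bracket a b r :
  defect D a b ** j r ** j (a ** b - b ** a) =
  - (j (a ** b - b ** a) ** j r ** defect D a b).
Proof.
have e : a ** (b ** r ** b) ** a + b ** (a ** r ** a) ** b =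
  a ** b ** r ** (b ** a) + b ** a ** r ** (a ** b) by nc_ring.
have := congr1 D e.
rewrite jder_triple DD !jder_quad !(homM hj) => {}e.
have ba : D (b ** a) = - D (a ** b) + D a ** j b + j a ** D b + D b ** j a
    + j b ** D a.
  by apply: (eq_of_eq (defectC a b)); rewrite /defect; nc_ring.
rewrite ba in e.
by apply: (eq_of_eq e); rewrite /defect (linearB j) !(homM hj); nc_ring.
Qed.

Lemma defectDl a b c : defect D (a + b) c = defect D a c + defect D b c.
Proof. by rewrite /defect cmulDl !DD linearD; nc_ring. Qed.

(** An alternating 2-cocycle is a Jordan derivation in each variable.  This
    allows everything known about [D] to be applied to its defect. *)
Lemma defect_jder c : jordan_derivation (defect D ^~ c).
Proof.
split=> [a b|a]; first exact: defectDl.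
(* The cocycle identity at the three placements of [c] among two copies of
   [a]; alternation makes the mixed terms cancel. *)
have e1 := defect_cocycle a a c; rewrite defect_diag in e1.
have e2 := defect_cocycle a c a; rewrite (defectC a (a ** c)) in e2.
have e3 := defect_cocycle c a a.
rewrite defect_diag (defectC (a ** a) c) (defectC a (c ** a)) in e3.
rewrite (defectC a c) in e2 e3.
apply: (eq_of_double_eq (f_equal2 +%R (f_equal2 +%R e1 (esym e2)) e3)).
by nc_ring.
Qed.

(** Multiplication by [u] changes side in the next two lemmas, so that
    conjugation by [u] in [A] becomes conjugation by its inverse in [B]. *)
Lemma defect_mull u b : defect D (u ** b) u = defect D b u ** j u.
Proof.
have e1 := defect_cocycle u u b; rewrite defect_diag in e1.
have e2 := jder_sq (defect_jder b) u; rewrite /= in e2.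
rewrite (defectC u (u ** b)) (defectC u b).
by apply: (eq_of_eq (f_equal2 +%R e1 (esym e2))); nc_ring.
Qed.

Lemma defect_mulr u b : defect D (b ** u) u = j u ** defect D b u.
Proof.
have e1 := defect_cocycle b u u; rewrite defect_diag in e1.
have e2 := jder_sq (defect_jder b) u.
rewrite /= (defectC b (u ** u)) (defectC b u) in e2.
by apply: (eq_of_eq (f_equal2 +%R e1 (esym e2))); nc_ring.
Qed.

End One.
End JordanDerivations.

(** * Bounded sequences *)

Section BoundedSequences.
Context {R : realType}.

Definition bounded_seq {V : normedModType R[i]} (f : nat -> V) :=
  exists K : R[i], forall n, `|f n| <= K.

Lemma eq0_of_bounded_muln (V : normedModType R[i]) (x : V) :
  bounded_seq (fun n => x *+ n) -> x = 0.
Proof.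
case=> K xK; apply/eqP; rewrite -normr_eq0; apply/eqP.
have K0 : 0 <= K := le_trans (normr_ge0 _) (xK 0%N).
move: xK; rewrite -(nonneg_complexE K0) -(nonneg_complexE (normr_ge0 x)).
set k := complex.Re K; set r := complex.Re `|x| => xK.
have r0 : 0 <= r by rewrite -ler0c (nonneg_complexE (normr_ge0 x)).
have k0 : 0 <= k by rewrite -ler0c (nonneg_complexE K0).
have rk n : r *+ n <= k.
  rewrite -lecR; apply: le_trans (xK n).
  by rewrite normrMn -(nonneg_complexE (normr_ge0 x)) rmorphMn.
move: r0; rewrite le_eqVlt => /predU1P[<-//|r0].
have := archi_boundP (divr_ge0 k0 (ltW r0)).
by rewrite ltr_pdivrMr// -mulr_natl ltNge mulr_natl mulr_natl rk.
Qed.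

Lemma bounded_seqD (V : normedModType R[i]) (f g : nat -> V) :
  bounded_seq f -> bounded_seq g -> bounded_seq (fun n => f n + g n).
Proof.
move=> [K fK] [L gL]; exists (K + L) => n.
by rewrite (le_trans (ler_normD _ _))// lerD.
Qed.

Lemma bounded_seqN (V : normedModType R[i]) (f : nat -> V) :
  bounded_seq f -> bounded_seq (fun n => - f n).
Proof. by move=> [K fK]; exists K => n; rewrite normrN. Qed.

Lemma bounded_seq_cst (V : normedModType R[i]) (x : V) : bounded_seq (fun=> x).
Proof. by exists `|x|. Qed.

Lemma bounded_seqM (B : cstarAlgType R) (f g : nat -> B) :
  bounded_seq f -> bounded_seq g -> bounded_seq (fun n => f n ** g n).
Proof.
move=> [K fK] [L gL]; exists (K * L) => n.
by rewrite (le_trans (norm_cmul _ _))// ler_pM.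
Qed.

Lemma bounded_affine (V : normedModType R[i]) (f : nat -> V) (x : V) :
  (forall n, f n.+1 = f n + x) -> bounded_seq f -> x = 0.
Proof.
move=> fS bf; apply: eq0_of_bounded_muln.
have fE n : f n = f 0%N + x *+ n.
  by elim: n => [|n IH]; rewrite ?addr0// fS IH mulrSr addrA.
have [K K_] := bounded_seqD bf (bounded_seqN (bounded_seq_cst (f 0%N))).
by exists K => n; have := K_ n; rewrite fE addrC addrA addNr add0r.
Qed.

(** The first differences are constant, so the sequence is an arithmetic
    progression. *)
Lemma bounded_second_difference (V : normedModType R[i]) (f : nat -> V) :
  (forall n, f n.+2 + f n = f n.+1 + f n.+1) -> bounded_seq f ->
  f 1%N = f 0%N.
Proof.
move=> ff bf; apply/eqP; rewrite -subr_eq0; apply/eqP.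
apply: (bounded_affine _ bf); elim=> [|n IH]; first by rewrite addrC subrK.
by apply: (addIr (f n)); rewrite ff {2}IH -addrA [_ + f n]addrC.
Qed.

End BoundedSequences.

(** * Unitary elements *)

Section Unitaries.
Context {R : realType} {B : unitalCStarAlgType R}.
Implicit Types (x y : B).

Lemma star0 : star (0 : B) = 0.
Proof. by apply: (addrI (star (0 : B))); rewrite -starD !addr0. Qed.

Lemma starN x : star (- x) = - star x.
Proof. by apply: (addIr (star x)); rewrite -starD !addNr star0. Qed.

Lemma norm_star_le x : `|star x| <= `|x|.
Proof.
have [->|x0] := eqVneq (star x) 0; first by rewrite normr0.
have sx0 : 0 < `|star x| by rewrite normr_gt0.
by rewrite -(ler_pM2r sx0) -expr2 -cstar_identity starK norm_cmul.
Qed.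

Lemma bounded_seq_star (f : nat -> B) :
  bounded_seq f -> bounded_seq (star \o f).
Proof.
by case=> K fK; exists K => n; apply: le_trans (norm_star_le _) (fK n).
Qed.

Lemma star1 : star (cone : B) = cone.
Proof. by rewrite -[LHS]cmul1x -{1}[cone]starK -starM cmul1x starK. Qed.

Lemma cstar_eq0 x : star x ** x = 0 -> x = 0.
Proof.
move=> x0; have := cstar_identity x; rewrite x0 normr0 => /esym/eqP.
by rewrite sqrf_eq0 normr_eq0 => /eqP.
Qed.

Lemma cstar_sq_eq0 x : star x ** x ** (star x ** x) = 0 -> x = 0.
Proof.
by move=> x0; apply/cstar_eq0/cstar_eq0; rewrite starM starK.
Qed.

Lemma norm_cone_le1 : `|cone : B| <= 1.
Proof.
have := cstar_identity (cone : B); rewrite star1 cmul1x => /eqP.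
rewrite -subr_eq0 -[X in X - _]mulr1 expr2 -mulrBr mulf_eq0 subr_eq0.
by case/orP => /eqP; [move->; exact: ler01|move=> <-].
Qed.

Definition unitary x := star x ** x = cone /\ x ** star x = cone.

Lemma unitaryV x : unitary x -> unitary (star x).
Proof. by case=> ? ?; split; rewrite starK. Qed.

Lemma unitaryM x y : unitary x -> unitary y -> unitary (x ** y).
Proof.
move=> [x1 x2] [y1 y2]; split; rewrite starM.
  by rewrite cmulA -[_ ** star x ** x]cmulA x1 cmulx1.
by rewrite cmulA -[_ ** y ** star y]cmulA y2 cmulx1.
Qed.

Lemma unitary_norm x : unitary x -> `|x| <= 1.
Proof.
move=> [x1 _]; rewrite -(@ler_pXn2r _ 2)// ?nnegrE// -cstar_identity x1 expr1n.
exact: norm_cone_le1.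
Qed.

Definition cpow x n := iter n (fun y => y ** x) cone.

Lemma cpowSl x n : cpow x n.+1 = x ** cpow x n.
Proof.
elim: n => [|n IH]; first by rewrite /= cmul1x cmulx1.
by rewrite -[LHS]/(cpow x n.+1 ** x) {1}IH -cmulA.
Qed.

Lemma bounded_cpow x : unitary x -> bounded_seq (cpow x).
Proof.
move=> /unitary_norm x1; exists 1; elim=> [|n IH]; first exact: norm_cone_le1.
by rewrite (le_trans (norm_cmul (cpow x n) x))// mulr_ile1.
Qed.

End Unitaries.

(** * Semiprimeness for elements of the larger algebra *)

Section Semiprime.
Context {R : realType} {A B : unitalCStarAlgType R}.
Context (j : {linear A -> B}) (hj : unital_star_hom j).
Variables (X : B) (p q : A) (sX : star X = j p ** X ** j q).

(** The adjoint of [X] being in [A X A], the square of [X^* X] contains the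
    factor [X A X A X]. *)
Lemma sandwich_eq0 :
  (forall s t, X ** j s ** X ** j t ** X = 0) -> X = 0.
Proof.
move=> XX; apply: cstar_sq_eq0; rewrite sX.
have -> : j p ** X ** j q ** X ** (j p ** X ** j q ** X) =
  j p ** (X ** j q ** X ** j p ** X) ** j q ** X by nc_ring.
by rewrite XX; nc_ring.
Qed.

(** The argument for [a r b + b r a = 0] in a semiprime ring, run with
    coefficients in [A] only: with [y = X r c] and [y' = X r' c], two
    ways of moving [X] past [c] give opposite values to [y s y'], which is
    thus zero.
    The square of [y^* y] contains such a product because the adjoint of [X]
    lies in [A X A]. *)
Lemma anticommute_eq0 (c : A) :
  (forall r, X ** j r ** j c = - (j c ** j r ** X)) ->
  forall r, X ** j r ** j c = 0.
Proof.
move=> h.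
have yy r s r' : (X ** j r ** j c) ** j s ** (X ** j r' ** j c) = 0.
  have h1 := h (r ** c ** s); rewrite !(homM hj) in h1.
  have e1 : (X ** j r ** j c) ** j s ** (X ** j r' ** j c) =
      j c ** j r ** j c ** j s ** X ** j r' ** X.
    rewrite (h r'); apply: (eq_of_eq (congr1 (fun z => - (z ** j r' ** X)) h1)).
    by nc_ring.
  have e2 : (X ** j r ** j c) ** j s ** (X ** j r' ** j c) =
      - (j c ** j r ** j c ** j s ** X ** j r' ** X).
    rewrite (h r) (h r').
    apply: (eq_of_eq (congr1 (fun z => j c ** j r ** z ** j r' ** X) (h s))).
    by nc_ring.
  by apply: (eq_of_double_eq (f_equal2 +%R e1 e2)); nc_ring.
move=> r; apply: cstar_sq_eq0; rewrite !starM sX -!(hom_star hj).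
have -> : forall cs rs,
    j cs ** (j rs ** (j p ** X ** j q)) ** (X ** j r ** j c) **
    (j cs ** (j rs ** (j p ** X ** j q)) ** (X ** j r ** j c)) =
  (j cs ** j rs ** j p ** X ** j q) ** (X ** j r ** j c **
    (j cs ** j rs ** j p) ** (X ** j q ** (X ** j r ** j c))).
  by move=> cs rs; nc_ring.
(* Moving the last [X] to the right exposes the vanishing product. *)
rewrite {2}h.
have := yy r (star c ** star r ** p) q; rewrite !(homM hj) => e.
apply: (eq_of_eq (congr1 (fun z =>
  - ((j (star c) ** j (star r) ** j p ** X ** j q) ** z ** j r ** X)) e)).
by nc_ring.
Qed.

End Semiprime.

(** * The defect vanishes on unitaries *)

Section UnitaryDefect.
Context {R : realType} {A B : unitalCStarAlgType R}.
Context (j : {linear A -> B}) (hj : unital_star_hom j).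

Lemma bounded_seq_hom (f : nat -> A) : bounded_seq f -> bounded_seq (j \o f).
Proof. by case=> K fK; exists K => n; apply: le_trans (hom_le hj _) (fK n). Qed.

(** Boundedness of an operator, in the form in which it composes. *)
Definition preserves_bounded (D : A -> B) :=
  forall f : nat -> A, bounded_seq f -> bounded_seq (D \o f).

Lemma bounded_defect (D : A -> B) c :
  preserves_bounded D -> preserves_bounded (defect j D ^~ c).
Proof.
move=> bD f bf; do 2?apply: bounded_seqD; try apply: bounded_seqN.
- by apply: bD; apply: bounded_seqM => //; exact: bounded_seq_cst.
- by apply: bounded_seqM; [exact: bD|exact: bounded_seq_cst].
- by apply: bounded_seqM; [exact: bounded_seq_hom|exact: bounded_seq_cst].
Qed.

Lemma bounded_sandwich (x y : B) (f : nat -> B) :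
  bounded_seq f -> bounded_seq (fun n => x ** f n ** y).
Proof.
move=> bf; apply: bounded_seqM; last exact: bounded_seq_cst.
by apply: bounded_seqM => //; exact: bounded_seq_cst.
Qed.

Section Absorption.
Variables (D : A -> B) (hD : jordan_derivation j D) (bD : preserves_bounded D).
Variables (x y : B) (g : A) (ug : unitary g).
Hypotheses (xg : x ** j g = x) (gy : j g ** y = y).

Let xgn n : x ** j (cpow g n) = x.
Proof.
elim: n => [|n IH]; first by rewrite (hom1 hj) cmulx1.
by rewrite (homM hj) cmulA IH.
Qed.

Let gny n : j (cpow g n) ** y = y.
Proof.
elim: n => [|n IH]; first by rewrite (hom1 hj) cmul1x.
by rewrite (homM hj) -cmulA gy.
Qed.

(** Between [x] and [y], which absorb [g], the map [n |-> D (g^n)] is additive;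
    it is also bounded. *)
Lemma sandwich_jder_absorbed : x ** D g ** y = 0.
Proof.
pose f n := x ** D (cpow g n) ** y.
apply: (@bounded_affine _ _ f).
  move=> n; have := jder_anti hD g (cpow g n).
  rewrite -cpowSl -[cpow g n ** g]/(cpow g n.+1) (jderD hD) => e.
  have e' := congr1 (fun z => x ** z ** y) e.
  apply: (eq_of_double_eq e'); rewrite /f.
  have -> : x ** (D g ** j (cpow g n) + j g ** D (cpow g n) +
      D (cpow g n) ** j g + j (cpow g n) ** D g) ** y =
    x ** D g ** (j (cpow g n) ** y) + x ** j g ** D (cpow g n) ** y +
    x ** D (cpow g n) ** (j g ** y) + x ** j (cpow g n) ** D g ** y.
    by nc_ring.
  by rewrite xg gy xgn gny; nc_ring.
by apply: bounded_sandwich; apply: bD; exact: bounded_cpow.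
Qed.

End Absorption.

(** The Jordan identity for [w g^(n+1)] and [g] involves [g (w g^n) g], whose
    value is the one at [w g^n]: the values along [w g^n] have zero second
    difference. *)
Lemma sandwich_jder_translate (D : A -> B) (hD : jordan_derivation j D)
    (bD : preserves_bounded D) (x : B) (g : A) (ug : unitary g) :
  (forall r, x ** j r ** j g = x ** j r) ->
  (forall r, j g ** j r ** x = j r ** x) ->
  forall w s t, x ** j s ** D (w ** g) ** j t ** x =
    x ** j s ** D w ** j t ** x.
Proof.
move=> xg gx w s t.
pose f n := x ** j s ** D (w ** cpow g n) ** j t ** x.
have Dg s' t' : x ** j s' ** D g ** j t' ** x = 0.
  rewrite -cmulA; apply: sandwich_jder_absorbed => //.
  by rewrite cmulA gx.
rewrite -[RHS]/(x ** j s ** D w ** j t ** x).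
have -> : x ** j s ** D w ** j t ** x = f 0%N by rewrite /f cmulx1.
have -> : x ** j s ** D (w ** g) ** j t ** x = f 1%N by rewrite /f /= cmul1x.
apply: bounded_second_difference; last first.
  rewrite /f => {f}; apply: bounded_seqM; last exact: bounded_seq_cst.
  apply: bounded_sandwich; apply: bD; apply: bounded_seqM.
    exact: bounded_seq_cst.
  exact: bounded_cpow.
move=> n; rewrite /f /= !cmulA; set a := w ** cpow g n.
have e1 := jder_anti hD (a ** g) g.
have e2 := jder_quad hj hD g a.
rewrite (jderD hD) cmulA e2 (homM hj) in e1.
have e := congr1 (fun z => x ** j s ** z ** j t ** x) e1.
have z1 : x ** j s ** (j g ** j a) ** D g ** j t ** x = 0.
  by rewrite -(homM hj) -[x ** _ ** _]cmulA -(homM hj).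
have z2 : x ** j s ** (j a ** j g) ** D g ** j t ** x = 0.
  by rewrite -(homM hj) -[x ** _ ** _]cmulA -(homM hj).
have f0 : x ** j s ** j g ** D a ** (j g ** j t ** x) =
  x ** j s ** D a ** (j t ** x) by rewrite xg gx.
have f1 : x ** j s ** D (a ** g) ** (j g ** j t ** x) =
  x ** j s ** D (a ** g) ** (j t ** x) by rewrite gx.
have f1' : x ** j s ** j g ** D (a ** g) ** j t ** x =
  x ** j s ** D (a ** g) ** j t ** x by rewrite xg.
(* [z1] and [z2] kill the terms in [D g]; the others reduce to values of the
   sequence after [g] is absorbed on either side. *)
apply: (eq_of_eq (f_equal2 +%R (f_equal2 +%R (f_equal2 +%R e (esym z1))
  (f_equal2 +%R z2 (esym f0))) (f_equal2 +%R f1 f1'))).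
by nc_ring.
Qed.


Lemma jder_star_unitary (D : A -> B) (hD : jordan_derivation j D) u :
  unitary u -> D (star u) = - (j (star u) ** D u ** j (star u)).
Proof.
move=> [u1 u2]; have e := jder_quad hj hD u (star u).
rewrite u2 cmul1x in e.
have k1 : j (star u) ** j u = cone by rewrite -(homM hj) u1 (hom1 hj).
have k2 : j u ** j (star u) = cone by rewrite -(homM hj) u2 (hom1 hj).
have e' : D u = D u ** (j (star u) ** j u) + j u ** D (star u) ** j u +
    (j u ** j (star u)) ** D u by rewrite {1}e; nc_ring.
rewrite k1 k2 in e'.
have e2 : D u + j u ** D (star u) ** j u = 0.
  by apply: (eq_of_eq (esym e')); nc_ring.
have := congr1 (fun z => j (star u) ** z ** j (star u)) e2.
have -> : j (star u) ** (D u + j u ** D (star u) ** j u) ** j (star u) =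
  j (star u) ** D u ** j (star u) +
  (j (star u) ** j u) ** D (star u) ** (j u ** j (star u)) by nc_ring.
by rewrite k1 k2 => e3; apply: (eq_of_eq e3); nc_ring.
Qed.

Section UnitaryPair.
Variables (D : A -> B) (hD : jordan_derivation j D) (bD : preserves_bounded D).
Hypothesis sD : forall a, D (star a) = star (D a).
Variables (u v : A) (uu : unitary u) (uv : unitary v).

Lemma star_defect a b :
  star (defect j D a b) = defect j D (star b) (star a).
Proof.
rewrite /defect !starD !starN !starM -!sD starM -!(hom_star hj).
by nc_ring.
Qed.

(** The defect of the adjoints can be computed from [X] itself because a Jordan
    derivation is determined at the inverse of a unitary. *)
Lemma star_defect_unitary : star (defect j D v u) =
  j (- (star u ** star v)) ** defect j D v u ** j (star v ** star u).
Proof.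
rewrite star_defect (jder_star_unitary (defect_jder hj hD (star v)) uu).
rewrite (defectC hD (star v) u) (jder_star_unitary (defect_jder hj hD u) uv).
by rewrite (linearN j) !(homM hj); nc_ring.
Qed.

Let x := defect j D v u.
(* The product [v g] is the conjugate [u v u^-1]. *)
Let g := star v ** u ** v ** star u.

Lemma defect_commutator r : x ** j r ** j (v ** u - u ** v) = 0.
Proof.
apply: (anticommute_eq0 hj star_defect_unitary) => {}r.
exact: defect_bracket.
Qed.

Let ug : unitary g.
Proof. by do !apply: unitaryM => //; exact: unitaryV. Qed.

Let gE : g = cone - star v ** (v ** u - u ** v) ** star u.
Proof.
have [[u1 u2] [v1 v2]] := (uu, uv).
have -> : star v ** (v ** u - u ** v) ** star u =
  (star v ** v) ** (u ** star u) - star v ** u ** v ** star u by nc_ring.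
by rewrite v1 u2 /g; nc_ring.
Qed.

Let xg r : x ** j r ** j g = x ** j r.
Proof.
rewrite gE (linearB j) (hom1 hj) !(homM hj).
have := defect_commutator (r ** star v); rewrite (homM hj) => e.
by apply: (eq_of_eq (congr1 (fun z => - (z ** j (star u))) e)); nc_ring.
Qed.

Let gx r : j g ** j r ** x = j r ** x.
Proof.
have e := defect_bracket hj hD v u (star u ** r).
rewrite defect_commutator (homM hj (star u)) in e.
rewrite gE (linearB j) (hom1 hj) !(homM hj (_ ** _)) (homM hj (star v)).
by apply: (eq_of_eq (congr1 (fun z => j (star v) ** z) (esym e))); nc_ring.
Qed.

(** The map [defect D _ u] sends [v] to [X] and [v g = u v u^-1] to
    [u^-1 X u]; between two copies of [X] these values agree. *)
Lemma sandwich_conj s t n :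
  x ** j s ** (j (cpow u n) ** x ** j (cpow (star u) n)) ** j t ** x =
  x ** j s ** x ** j t ** x.
Proof.
have [u1 u2] := uu; have [v1 v2] := uv.
have k1 : j (star u) ** j u = cone by rewrite -(homM hj) u1 (hom1 hj).
have k2 : j u ** j (star u) = cone by rewrite -(homM hj) u2 (hom1 hj).
have step s' t' : x ** j s' ** j u ** x ** j (star u) ** j t' ** x =
    x ** j s' ** x ** j t' ** x.
  have bd := bounded_defect u bD; have jd := defect_jder hj hD u.
  have := sandwich_jder_translate jd bd ug xg gx v (s' ** u) (star u ** t').
  have -> : v ** g = u ** (v ** star u).
    have -> : v ** g = (v ** star v) ** u ** v ** star u by rewrite /g; nc_ring.
    by rewrite v2; nc_ring.
  rewrite (defect_mull hj hD).
  have e := defect_mulr hj hD u (v ** star u).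
  rewrite -cmulA u1 cmulx1 in e.
  rewrite -/x in e *; rewrite !(homM hj).
  set y := defect j D (v ** star u) u in e *.
  have -> : x ** (j s' ** j u) ** (y ** j u) ** (j (star u) ** j t') ** x =
    x ** j s' ** (j u ** y) ** (j u ** j (star u)) ** j t' ** x by nc_ring.
  by rewrite -e k2 cmulx1 => ->; nc_ring.
elim: n s t => [|n IH] s t.
  by rewrite /= (hom1 hj); nc_ring.
rewrite cpowSl -[cpow (star u) n.+1]/(cpow (star u) n ** star u).
rewrite !(homM hj).
have := IH (s ** u) (star u ** t); rewrite !(homM hj) => e.
have e2 := step s t.
by apply: (eq_of_eq (f_equal2 +%R e e2)); nc_ring.
Qed.

Lemma defect_unitary : x = 0.
Proof.
have [u1 u2] := uu.
have k1 : j (star u) ** j u = cone by rewrite -(homM hj) u1 (hom1 hj).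
have k2 : j u ** j (star u) = cone by rewrite -(homM hj) u2 (hom1 hj).
apply: (sandwich_eq0 star_defect_unitary) => s t.
have d0 n : defect j D (cpow u n) u = 0.
  elim: n => [|n IH]; first by rewrite (jder1 hj (defect_jder hj hD u)).
  by rewrite (defect_mulr hj hD) IH cmulx0.
have dx n : defect j D (v ** cpow u n) u = j (cpow u n) ** x.
  elim: n => [|n IH]; first by rewrite /= cmulx1 (hom1 hj) cmul1x.
  by rewrite cmulA (defect_mulr hj hD) IH cpowSl (homM hj) cmulA.
have dS n : defect j D v (cpow u n.+1) =
    j (cpow u n) ** x + defect j D v (cpow u n) ** j u.
  have e := defect_cocycle hj D v (cpow u n) u.
  rewrite d0 dx in e.
  by apply: (eq_of_eq (esym e)); rewrite /=; nc_ring.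
(* The factor [u] in front of [t] compensates the excess of inverses over
   powers of [u] in each summand. *)
pose f n := x ** j s ** (defect j D v (cpow u n) ** j (cpow (star u) n))
  ** j (u ** t) ** x.
apply: (@bounded_affine _ _ f) => [n|].
  have c1 : j (cpow (star u) n.+1) = j (star u) ** j (cpow (star u) n).
    by rewrite cpowSl (homM hj).
  have c2 : j (cpow (star u) n.+1) = j (cpow (star u) n) ** j (star u).
    by rewrite /= (homM hj).
  rewrite -(sandwich_conj s t n) /f dS (homM hj).
  have -> : forall y d c, x ** j s ** ((y ** x + d ** j u) ** c) **
      (j u ** j t) ** x =
    x ** j s ** (y ** x ** c) ** j u ** j t ** x +
    x ** j s ** (d ** (j u ** c)) ** (j u ** j t) ** x.
    by move=> y d c; nc_ring.
  rewrite {1}c2 c1 [j u ** (_ ** _)]cmulA k2 cmul1x addrC; congr (_ + _).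
  have -> : forall y c, x ** j s ** (y ** x ** (c ** j (star u))) ** j u ** j t
    ** x = x ** j s ** (y ** x ** c) ** (j (star u) ** j u) ** j t ** x.
    by move=> y c; nc_ring.
  by rewrite k1 cmulx1.
apply: bounded_seqM; last exact: bounded_seq_cst.
apply: bounded_sandwich; apply: bounded_seqM; last first.
  by apply: bounded_seq_hom; apply: bounded_cpow; exact: unitaryV.
have [K K_] := bounded_defect v bD (bounded_cpow uu).
by exists K => n; have := K_ n; rewrite /= (defectC hD v) normrN.
Qed.

End UnitaryPair.
End UnitaryDefect.

(** * Expansion in a small parameter *)

Section NeumannSeries.
Context {R : realType} {A : unitalCStarAlgType R}.
Variables (x : A) (x2 : `|x| <= 2^-1).

Let half_lt1 : (2^-1 : R[i]) <= 1.
Proof. by rewrite invf_le1// ler1n. Qed.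

(* The partial sums of the geometric series, the [n]-th one having [n] terms. *)
Let s n := iter n (fun y => cone + x ** y) 0.

Let sSr n : s n.+1 = cone + s n ** x.
Proof.
elim: n => [|n IH]; first by rewrite /= cmulx0 cmul0x.
by rewrite -[LHS]/(cone + x ** s n.+1) {1}IH /=; nc_ring.
Qed.

(* The Cauchy estimate, as the tail is [x^n] times a bounded sum. *)
Let sD n k : s (n + k)%N = s n + cpow x n ** s k.
Proof.
elim: n => [|n IH]; first by rewrite add0n /= cmul1x add0r.
by rewrite addSn cpowSl /= IH; nc_ring.
Qed.

Let s_le2 n : `|s n| <= 2.
Proof.
elim: n => [|n IH]; first by rewrite normr0.
rewrite /= (le_trans (ler_normD _ _))// -[2]/(1 + 1) lerD ?norm_cone_le1//.
rewrite (le_trans (norm_cmul _ _))// (le_trans (ler_pM _ _ x2 IH))//.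
by rewrite mulVf// pnatr_eq0.
Qed.

Let cpow_le n : `|cpow x n| <= n.+1%:R^-1.
Proof.
have : `|cpow x n| <= 2^-1 ^+ n.
  elim: n => [|n IH]; first by rewrite expr0 norm_cone_le1.
  by rewrite exprSr (le_trans (norm_cmul (cpow x n) x))// ler_pM.
move/le_trans; apply.
by rewrite exprVn -natrX lef_pV2 ?posrE ?ltr0n ?expn_gt0// ler_nat ltn_expl.
Qed.

Let s_cvg : exists y : A, s @ \oo --> y.
Proof.
suff : cvg (s @ \oo) by move=> c; exists (lim (s @ \oo)).
apply: cauchy_cvg; apply: cauchy_exP => e e0.
have [N eN] : exists N : nat, 2 / N.+1%:R < e.
  have re0 : 0 < complex.Re e by rewrite -ltcR (nonneg_complexE (ltW e0)).
  exists (Num.bound (2 / complex.Re e)).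
  have := archi_boundP (divr_ge0 (ler0n R 2) (ltW re0)).
  set k := Num.bound _ => k_.
  rewrite -(nonneg_complexE (ltW e0)) ltr_pdivrMr ?ltr0n// mulrC.
  rewrite -[2]/(2%:R) -(rmorph_nat (real_complex R) 2).
  rewrite -(rmorph_nat (real_complex R) k.+1) -rmorphM ltcR.
  rewrite -ltr_pdivrMr//; apply: lt_trans k_ _.
  by rewrite ltr_nat.
exists (s N); exists N => // n /= Nn.
rewrite -ball_normE /= -(subnKC Nn) sD opprD addNKr normrN.
apply: le_lt_trans eN; rewrite (le_trans (norm_cmul _ _))//.
by rewrite mulrC; apply: ler_pM => //; rewrite ?s_le2 ?cpow_le.
Qed.

Lemma neumann_inverse : exists y : A,
  [/\ `|y| <= 2, y = cone + x ** y & y = cone + y ** x].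
Proof.
have [y sy] := s_cvg.
have sSy : (fun n => s n.+1) @ \oo --> y.
  by apply: (cvg_comp (addn 1%N) s (cvg_addnl 1) sy).
have xle1 : `|x| <= 1 := le_trans x2 half_lt1.
have e1 : y = cone + x ** y.
  apply: (cvg_unique _ sSy); first exact: norm_hausdorff.
  apply/cvgrPdist_lt => e e0; move/cvgrPdist_lt : sy => /(_ e e0).
  apply: filterS => n; apply: le_lt_trans.
  have -> : cone + x ** y - s n.+1 = x ** (y - s n) by rewrite /=; nc_ring.
  by rewrite (le_trans (norm_cmul _ _))// ler_piMl.
have e2 : y = cone + y ** x.
  apply: (cvg_unique _ sSy); first exact: norm_hausdorff.
  apply/cvgrPdist_lt => e e0; move/cvgrPdist_lt : sy => /(_ e e0).
  apply: filterS => n; apply: le_lt_trans.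
  have -> : cone + y ** x - s n.+1 = (y - s n) ** x by rewrite sSr; nc_ring.
  by rewrite (le_trans (norm_cmul _ _))// ler_piMr.
exists y; split=> //.
have : `|y| <= 1 + 2^-1 * `|y|.
  rewrite {1}e1 (le_trans (ler_normD _ _))// lerD ?norm_cone_le1//.
  by rewrite (le_trans (norm_cmul _ _))// ler_wpM2r.
rewrite -lerBlDr -[X in X - _]mul1r -mulrBl.
have -> : 1 - 2^-1 = 2^-1 :> R[i].
  by rewrite {1}(splitr 1) mul1r addrK.
by rewrite ler_pdivrMl// mulr1.
Qed.

End NeumannSeries.
Section HomogeneousParts.
Context {R : realType} {A B : unitalCStarAlgType R}.

(** Comparison of leading terms without limits: for [t] the inverse of a large
    integer, division by [t ^ (m + 1)] shows that this integer multiple of [f x]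
    is bounded.  The second argument of [r] is meant for the inverse of
    [1 - t x]. *)
Lemma homogeneous_eq0 (f : A -> B) (r : A -> A -> B) (m : nat) (x : A) :
  (forall t : R[i], f (t *: x) = t ^+ m *: f x) ->
  (forall (t : R[i]) y, r (t *: x) y = t ^+ m.+1 *: r x y) ->
  (forall y, bounded_seq y -> bounded_seq (fun n => r x (y n))) ->
  (forall t : R[i], t^* = t -> `|t *: x| <= 2^-1 ->
    exists2 y, `|y| <= 2 & f (t *: x) = r (t *: x) y) ->
  f x = 0.
Proof.
move=> fZ rZ rb fr.
(* Multiples of [x] by the inverse of an integer above [k] are small. *)
pose k := Num.bound (2 * complex.Re `|x|).
have rx : (complex.Re `|x|)%:C%C = `|x| := nonneg_complexE (normr_ge0 x).
have rx0 : 0 <= complex.Re `|x| by rewrite -ler0c rx.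
pose t n : R[i] := (k + n).+1%:R^-1.
have t0 n : t n != 0 by rewrite invr_eq0 pnatr_eq0.
have t_small n : `|t n *: x| <= 2^-1.
  rewrite normrZ normfV normr_nat mulrC ler_pdivrMr ?ltr0n// ler_pdivlMl//.
  rewrite -rx -[2]/(2%:R) -(rmorph_nat (real_complex R) 2).
  rewrite -(rmorph_nat (real_complex R) (k + n).+1) -rmorphM lecR.
  apply: (le_trans (ltW (archi_boundP (mulr_ge0 (ler0n R 2) rx0)))).
  by rewrite ler_nat -addnS leq_addr.
have /choice[y yP] : forall n, exists y, `|y| <= 2 /\ f x *+ (k + n).+1 = r x y.
  move=> n; have [|y y2 e] := fr (t n) _ (t_small n).
    by rewrite /t fmorphV rmorph_nat.
  exists y; split=> //.
  move: e; rewrite fZ rZ exprSr -scalerA.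
  move/(scalerI (expf_neq0 m (t0 n))) => ->.
  by rewrite /t -scaler_nat scalerA mulfV ?pnatr_eq0// scale1r.
apply: (@bounded_affine _ _ (fun n => f x *+ (k + n).+1)).
  by move=> n; rewrite addnS mulrSr.
have [|K K_] := rb y; first by exists 2 => n; have [] := yP n.
by exists K => n; have [_ ->] := yP n.
Qed.

End HomogeneousParts.

(** * A bounded operator is determined by its values on unitaries *)

Section UnitarySpan.
Context {R : realType} {A B : unitalCStarAlgType R}.
Variables (f : A -> B).
Hypotheses (fD : forall a b, f (a + b) = f a + f b)
  (fZ : forall (k : R[i]) a, f (k *: a) = k *: f a)
  (bf : preserves_bounded f) (fU : forall u, unitary u -> f u = 0).

(** Here [y] is the inverse of [1 - z], and the element is the Cayley transform
    [(1 + z) (1 - z)^-1]. *)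
Lemma cayley_unitary (z y : A) : star z = - z ->
  y = cone + z ** y -> y = cone + y ** z ->
  unitary (cone + z ** y + z ** y).
Proof.
move=> sz e1 e2.
have y1 : (cone - z) ** y = cone by apply: (eq_of_eq e1); nc_ring.
have y2 : y ** (cone - z) = cone by apply: (eq_of_eq e2); nc_ring.
have s1 : star y ** (cone + z) = cone.
  by rewrite -[cone + z]starK -starM starD star1 sz y1 star1.
have s2 : (cone + z) ** star y = cone.
  by rewrite -[cone + z]starK -starM starD star1 sz y2 star1.
have u1 : cone + z ** y + z ** y = (cone + z) ** y.
  by apply: (eq_of_eq (esym e1)); nc_ring.
have u2 : (cone + z) ** y = y ** (cone + z).
  by apply: (eq_of_eq (etrans y2 (esym y1))); nc_ring.
have su : star ((cone + z) ** y) = star y ** (cone - z).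
  by rewrite starM starD star1 sz.
rewrite u1; split; rewrite su.
  have -> : star y ** (cone - z) ** ((cone + z) ** y) =
    star y ** (cone + z) ** ((cone - z) ** y) by nc_ring.
  by rewrite y1 s1 cmul1x.
by rewrite u2 cmulA -[_ ** star y]cmulA s2 cmulx1.
Qed.

(** The Cayley transform of [t z] is [1 + 2 t z] up to second order. *)
Lemma unitary_span_skew z : star z = - z -> f z = 0.
Proof.
move=> sz.
have f1 : f cone = 0 by apply: fU; split; rewrite star1 cmul1x.
apply: (@homogeneous_eq0 _ _ _ f (fun a y => - f (a ** a ** y)) 1).
- by move=> t; rewrite expr1 fZ.
- by move=> t y; rewrite cmulZl cmulZr !cmulZl scalerA fZ scalerN expr2.
- move=> y by_; apply: bounded_seqN; apply: bf.
  by apply: bounded_seqM => //; exact: bounded_seq_cst.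
move=> t tr tz; have [y [y2 e1 e2]] := neumann_inverse tz; exists y => //.
have st : star (t *: z) = - (t *: z) by rewrite starZ tr sz scalerN.
have := fU (cayley_unitary st e1 e2).
set a := t *: z in e1 e2 *.
have -> : cone + a ** y + a ** y = cone + (a + a ** a ** y) + (a + a ** a ** y).
  have -> : a ** y = a + a ** a ** y by rewrite {1}e1; nc_ring.
  by [].
rewrite !fD f1 => e.
by apply: (eq_of_double_eq e); nc_ring.
Qed.

Lemma unitary_span a : f a = 0.
Proof.
have i1 : star ('i *: (a + star a)) = - ('i *: (a + star a)).
  by rewrite starZ conjCi scaleNr starD starK addrC.
have fs := unitary_span_skew i1.
have s2 : star (a - star a) = - (a - star a).
  by rewrite starD starN starK opprB addrC.
have fk := unitary_span_skew s2.
move: fs; rewrite fZ => /eqP; rewrite scaler_eq0 => /orP[|/eqP].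
  by rewrite (negbTE (neq0Ci _)).
move: fk; rewrite !fD => e1 e2.
have fN b : f (- b) = - f b by rewrite -scaleN1r fZ scaleN1r.
by rewrite fN in e1; apply: (eq_of_double_eq (f_equal2 +%R e1 e2)); nc_ring.
Qed.

End UnitarySpan.

(** * From triple derivations at the unit to derivations *)

Section InverseIdentity.
Context {R : realType} {A B : unitalCStarAlgType R}.
Context (j : {linear A -> B}) (hj : unital_star_hom j).

Definition star_conj (D : A -> B) a := star (D (star a)).

Variables (D : A -> B).
Hypotheses (D_add : forall a b, D (a + b) = D a + D b)
  (DZ : forall (k : R[i]) a, D (k *: a) = k *: D a)
  (D1 : D cone = 0) (bD : preserves_bounded D).
Hypothesis inverse_identity : forall a y, a ** y = cone -> y ** a = cone ->
  D a ** j y + j y ** D a + j a ** star_conj D y + star_conj D y ** j a = 0.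

Let jZ (k : R[i]) a : j (k *: a) = k *: j a.
Proof. exact: linearZ. Qed.

Let SD a b : star_conj D (a + b) = star_conj D a + star_conj D b.
Proof. by rewrite /star_conj (starD a b) D_add -starD. Qed.

Let SZ (k : R[i]) a : star_conj D (k *: a) = k *: star_conj D a.
Proof. by rewrite /star_conj starZ DZ starZ conjCK. Qed.

Let S1 : star_conj D cone = 0.
Proof. by rewrite /star_conj star1 D1 star0. Qed.

Let bS : preserves_bounded (star_conj D).
Proof.
by move=> f bf; apply: bounded_seq_star; apply: bD; exact: bounded_seq_star.
Qed.

(* The identity at [1 - z] and its inverse [y]. *)
Let resolvent_identity z y : y = cone + z ** y -> y = cone + y ** z ->
  star_conj D (z ** y) + star_conj D (z ** y) =
  D z ** j y + j y ** D z + j z ** star_conj D y + star_conj D y ** j z.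
Proof.
move=> e1 e2.
have y1 : (cone - z) ** y = cone by apply: (eq_of_eq e1); nc_ring.
have y2 : y ** (cone - z) = cone by apply: (eq_of_eq e2); nc_ring.
have DN : D (cone - z) = - D z.
  by rewrite -scaleN1r D_add DZ D1 scaleN1r add0r.
have := inverse_identity y1 y2; rewrite DN (linearB j) (hom1 hj) => e.
have sy : star_conj D y = star_conj D (z ** y) by rewrite {1}e1 SD S1 add0r.
by apply: (eq_of_eq e); rewrite -sy; nc_ring.
Qed.

(** The first order terms of the identity at [1 - t x] are those of
    [2 star_conj D x - 2 D x]. *)
Lemma inverse_identity_star a : D (star a) = star (D a).
Proof.
suff e x : star_conj D x = D x by rewrite -(e a) /star_conj starK.
suff : star_conj D x - D x + (star_conj D x - D x) = 0.
  by move=> e; apply: (eq_of_double_eq e); nc_ring.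
pose r z y := D z ** j (z ** y) + j (z ** y) ** D z +
   j z ** star_conj D (z ** y) + star_conj D (z ** y) ** j z
   - star_conj D (z ** z ** y) - star_conj D (z ** z ** y).
apply: (@homogeneous_eq0 _ _ _
  (fun x => star_conj D x - D x + (star_conj D x - D x)) r 1).
- by move=> t; rewrite SZ DZ expr1 !scalerDr !scalerN.
- move=> t y; rewrite /r !(cmulZl, cmulZr, DZ, jZ, SZ, scalerA).
  by rewrite expr2 !(scalerDr, scalerN).
- move=> y bY; rewrite /r.
  have bxy : bounded_seq (fun n => x ** y n).
    by apply: bounded_seqM => //; exact: bounded_seq_cst.
  have bxxy : bounded_seq (fun n => x ** x ** y n).
    by apply: bounded_seqM => //; exact: bounded_seq_cst.
  repeat apply: bounded_seqD; try apply: bounded_seqN; try exact: bS;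
  apply: bounded_seqM; try exact: bounded_seq_cst; try exact: bS;
  exact: bounded_seq_hom.
move=> t _ tz; have [y [y2 e1 e2]] := neumann_inverse tz; exists y => //.
move: (t *: x) e1 e2 => z e1 e2.
have := resolvent_identity e1 e2.
have zy : z ** y = z + z ** z ** y by rewrite {1}e1; nc_ring.
have -> : star_conj D y = star_conj D (z ** y) by rewrite {1}e1 SD S1 add0r.
have -> : j y = cone + j (z ** y) by rewrite {1}e1 (linearD j) (hom1 hj).
rewrite {1 2}zy SD => e.
by apply: (eq_of_eq e); rewrite /r; nc_ring.
Qed.

(** Once [D] is symmetric the first order terms cancel, and the second order
    ones are those of [2 D (x x) - 2 (D x x + x D x)]. *)
Lemma inverse_identity_jder : jordan_derivation j D.
Proof.
split=> [a b|x]; first exact: D_add.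
have sE a : star_conj D a = D a.
  by rewrite /star_conj inverse_identity_star starK.
suff : D (x ** x) - (D x ** j x + j x ** D x) +
    (D (x ** x) - (D x ** j x + j x ** D x)) = 0.
  by move=> e; apply: (eq_of_double_eq e); nc_ring.
pose r z y := D z ** j (z ** z ** y) + j (z ** z ** y) ** D z +
   j z ** D (z ** z ** y) + D (z ** z ** y) ** j z
   - D (z ** z ** z ** y) - D (z ** z ** z ** y).
apply: (@homogeneous_eq0 _ _ _ (fun x => D (x ** x) -
  (D x ** j x + j x ** D x) + (D (x ** x) - (D x ** j x + j x ** D x))) r 2).
- move=> t; rewrite !(cmulZl, cmulZr, DZ, jZ, scalerA).
  by rewrite expr2 !(scalerDr, scalerN, opprD).
- move=> t y; rewrite /r !(cmulZl, cmulZr, DZ, jZ, scalerA).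
  by rewrite !exprS expr0 mulr1 !mulrA !(scalerDr, scalerN).
- move=> y bY; rewrite /r.
  have bxxy : bounded_seq (fun n => x ** x ** y n).
    by apply: bounded_seqM => //; exact: bounded_seq_cst.
  have bxxxy : bounded_seq (fun n => x ** x ** x ** y n).
    by apply: bounded_seqM => //; exact: bounded_seq_cst.
  repeat apply: bounded_seqD; try apply: bounded_seqN; try exact: bD;
  apply: bounded_seqM; try exact: bounded_seq_cst; try exact: bD;
  exact: bounded_seq_hom.
move=> t _ tz; have [y [y2 e1 e2]] := neumann_inverse tz; exists y => //.
move: (t *: x) e1 e2 => z e1 e2.
have := resolvent_identity e1 e2; rewrite !sE.
have zy : z ** y = z + z ** z ** y by rewrite {1}e1; nc_ring.
have jy : j y = cone + (j z + j (z ** z ** y)).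
  by rewrite {1}e1 zy !(linearD j) (hom1 hj).
have Dy : D y = D z + D (z ** z ** y).
  by rewrite {1}e1 D_add D1 zy D_add add0r.
have Dzzy : D (z ** z ** y) = D (z ** z) + D (z ** z ** z ** y).
  have -> : z ** z ** y = z ** z + z ** z ** z ** y by rewrite {1}e1; nc_ring.
  by rewrite D_add.
have -> : D (z ** y) = D z + D (z ** z ** y) by rewrite zy D_add.
rewrite jy Dy {1 2}Dzzy => e.
by apply: (eq_of_eq e); rewrite /r; nc_ring.
Qed.

End InverseIdentity.

Section TripleDerivation.
Context {R : realType} {A B : unitalCStarAlgType R}.
Context (j : {linear A -> B}) (hj : unital_star_hom j).
Context (T : {linear A -> B}).
Hypothesis bT : preserves_bounded T.
Hypothesis hT : forall a b c : A, triple a b c = cone ->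
  T cone = triple (T a) (j b) (j c) + triple (j a) (T b) (j c)
           + triple (j a) (j b) (T c).

Let D a := T a - T cone ** j a.

Let D_add a b : D (a + b) = D a + D b.
Proof. by rewrite /D !linearD; nc_ring. Qed.

Let DZ (k : R[i]) a : D (k *: a) = k *: D a.
Proof. by rewrite /D !linearZ cmulZr scalerBr. Qed.

Let D1 : D cone = 0.
Proof. by rewrite /D (hom1 hj); nc_ring. Qed.

Let bD : preserves_bounded D.
Proof.
move=> f bf; apply: bounded_seqD; first exact: bT.
apply: bounded_seqN; apply: bounded_seqM; first exact: bounded_seq_cst.
exact: bounded_seq_hom.
Qed.

Let jZ (k : R[i]) a : j (k *: a) = k *: j a.
Proof. exact: linearZ. Qed.

Let half_double (C : unitalCStarAlgType R) (x : C) :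
  (2^-1 : R[i]) *: (x + x) = x.
Proof. by rewrite scalerDr -scalerDl -div1r -splitr scale1r. Qed.

Let double_triple (C : unitalCStarAlgType R) (a b c : C) :
  triple a b c + triple a b c = a ** star b ** c + c ** star b ** a.
Proof.
by rewrite /triple -scalerDl -div1r -splitr scale1r.
Qed.

Let star_T1 : star (T cone) = - T cone.
Proof.
have e : triple (cone : A) cone cone = cone.
  by rewrite /triple star1 !cmul1x half_double.
have e1 := hT e; rewrite (hom1 hj) in e1.
have := f_equal2 +%R e1 e1.
set X := triple _ _ _; set Y := triple _ _ _; set Z := triple _ _ _.
have -> : X + Y + Z + (X + Y + Z) = (X + X) + (Y + Y) + (Z + Z) by nc_ring.
rewrite !double_triple star1 => {}e.
by apply: (eq_of_double_eq (esym e)); nc_ring.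
Qed.

(* The hypothesis on [T] at [a], the adjoint of [y], and [1]; the terms in
   [T(1)] cancel because [T(1)] is skew. *)
Let inverse_identity a y : a ** y = cone -> y ** a = cone ->
  D a ** j y + j y ** D a + j a ** star_conj D y + star_conj D y ** j a = 0.
Proof.
move=> ay ya.
have e : triple a (star y) cone = cone.
  by rewrite /triple starK cmul1x cmulx1 ay ya half_double.
have e1 := hT e; rewrite (hom1 hj) in e1.
have := f_equal2 +%R e1 e1.
set X := triple _ _ _; set Y := triple _ _ _; set Z := triple _ _ _.
have -> : X + Y + Z + (X + Y + Z) = (X + X) + (Y + Y) + (Z + Z) by nc_ring.
have jay : j a ** j y = cone by rewrite -(homM hj) ay (hom1 hj).
have jya : j y ** j a = cone by rewrite -(homM hj) ya (hom1 hj).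
have dy : star_conj D y = star (T (star y)) + j y ** T cone.
  rewrite /star_conj /D starD starN starM star_T1 -(hom_star hj) starK.
  by nc_ring.
rewrite !double_triple -!(hom_star hj) starK dy /D => {}e.
have f1 : T cone ** (j a ** j y) = T cone by rewrite jay cmulx1.
have f2 : T cone ** (j y ** j a) = T cone by rewrite jya cmulx1.
apply: (eq_of_eq (f_equal2 +%R (esym e) (f_equal2 +%R (esym f1) (esym f2)))).
by nc_ring.
Qed.

Theorem triple_derivation_at_unit a b :
  T (a ** b) = T a ** j b + j a ** T b - j a ** T cone ** j b.
Proof.
have D_star := inverse_identity_star hj D_add DZ D1 bD inverse_identity.
have D_jder := inverse_identity_jder hj D_add DZ D1 bD inverse_identity.
have dZ (k : R[i]) c d : defect j D (k *: c) d = k *: defect j D c d.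
  rewrite /defect cmulZl !DZ jZ !cmulZl.
  by rewrite -!scalerN -!scalerDr.
have du u c : unitary u -> defect j D c u = 0.
  move=> uu; apply: (@unitary_span _ _ _ (defect j D ^~ u)) => //.
  - by move=> ? ?; exact: defectDl.
  - by move=> ? ?; exact: dZ.
  - exact: (bounded_defect hj u bD).
  - by move=> v uv; exact: (defect_unitary hj D_jder bD D_star).
have : defect j D b a = 0.
  apply: (@unitary_span _ _ _ (defect j D ^~ a)) => //.
  - by move=> ? ?; exact: defectDl.
  - by move=> ? ?; exact: dZ.
  - exact: (bounded_defect hj a bD).
  - by move=> v uv; rewrite (defectC D_jder) du// oppr0.
rewrite (defectC D_jder) /defect /D (homM hj) => e.
by apply: (eq_of_eq (congr1 -%R e)); nc_ring.
Qed.

End TripleDerivation.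

Theorem theorem2p3 (R : realType) (B : unitalCStarAlgType R)
  (A : cstarSubalg B) (unit_in_A : (cone : B) \in A)
  (T : {linear elt A -> B}) (cT : continuous T)
  (dT : triple_derivation_at T (Sub cone unit_in_A)) :
  generalized_derivation T.
Proof.
pose e : elt A := Sub cone unit_in_A.
have e1 : left_id e cmul by move=> a; apply: val_inj; rewrite /= cmul1x.
have e2 : right_id e cmul by move=> a; apply: val_inj; rewrite /= cmulx1.
(* The unit lies in the subalgebra, whose elements thus form a unital
   algebra of their own. *)
pose A1 : unitalCStarAlgType R :=
  HB.pack (elt A) (@hasUnit.Build R (elt A) e e1 e2).
pose j : {linear A1 -> B} := (\val : {linear elt A -> B}).
have hj : unital_star_hom j by split.
have bT : @preserves_bounded R A1 B T.
  have /(@linear_boundedP R[i] (elt A) B T)/pinfty_ex_gt0[M M0 TM] :=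
    (@linear_bounded_continuous R[i] (elt A) B T).2 cT.
  move=> f [K fK]; exists (M * K) => n.
  by apply: le_trans (TM (f n)) _; rewrite ler_pM2l//; exact: fK.
have TM := @triple_derivation_at_unit R A1 B j hj T bT dT.
exists (bidual_inj (T e)) => a b.
have -> : T (a ** b) =
  T a ** \val b + \val a ** T b - \val a ** T e ** \val b := TM a b.
by rewrite -!bidual_injM; apply: dualP_eq => f; rewrite /= linearB linearD.
Qed.
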